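(* Let $\mu>0$ and let $\mathcal W$ be the worm domain. Then $\mathcal W$ is smoothly bounded and pseudoconvex. Moreover, its boundary is strongly pseudoconvex except at the boundary points $(0,z_2)$ with $\big|\log|z_2|^2\big|\le\mu$. (These points constitute an annulus in $\partial\mathcal W$.)
   Context: For $\mu>0$, the worm domain is $$\mathcal W=\Big\{(z_1,z_2)\in\mathbf C^2:\ \big|z_1-e^{i\log|z_2|^2}\big|^2<1-\eta(\log|z_2|^2)\Big\}$$ (so $z_2\ne 0$), where $\eta:\mathbf R\to\mathbf R$ is a fixed $C^\infty$ function satisfying: (i) $\eta\ge0$, $\eta$ is even, $\eta$ is convex; (ii) $\eta^{-1}(0)=[-\mu,\mu]$; (iii) there is $a>0$ such that $\eta(x)>1$ if $|x|>a$; (iv) $\eta'(x)\neq0$ if $\eta(x)=1$. ''Smoothly bounded'' means bounded with $C^\infty$ boundary. Pseudoconvex means Levi pseudoconvex: the Levi form of a defining function is positive semi-definite on the complex tangent space at every boundary point; a boundary point is strongly pseudoconvex if the Levi form is positive definite on the complex tangent space there. *)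

(* Defs.v *)
From Stdlib Require Import Reals List.
From Coquelicot Require Import Coquelicot.
Import ListNotations.
Open Scope R_scope.

(** * Differential operators on C^2 *)

Definition C2 : Type := (C * C)%type.

Definition e1 : C2 := (RtoC 1, RtoC 0).
Definition e2 : C2 := (RtoC 0, RtoC 1).

Definition C2scal (c : C) (v : C2) : C2 := (Cmult c (fst v), Cmult c (snd v)).

Definition C2plus (p v : C2) : C2 := (Cplus (fst p) (fst v), Cplus (snd p) (snd v)).

Definition line (p v : C2) (t : R) : C2 := C2plus p (C2scal (RtoC t) v).

(** Real directional derivative; [ddir e1], [ddir (C2scal Ci e1)], [ddir e2] and
    [ddir (C2scal Ci e2)] are the partial derivatives in x1, y1, x2, y2. *)
Definition ddir (v : C2) (f : C2 -> R) (p : C2) : R :=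
  Derive (fun t => f (line p v t)) 0.

Definition ddirs (l : list C2) (f : C2 -> R) : C2 -> R := fold_right ddir f l.

(** [Derive] is total, so the existence of every iterated derivative has to be
    required along with its continuity. *)
Definition smooth_on (U : C2 -> Prop) (f : C2 -> R) : Prop :=
  forall (l : list C2) (p : C2), U p ->
    (forall v : C2, ex_derive (fun t => ddirs l f (line p v t)) 0) /\
    continuous (ddirs l f : C * C -> R) p.

Definition ddirC (v : C2) (F : C2 -> C) (p : C2) : C :=
  (ddir v (fun q => fst (F q)) p, ddir v (fun q => snd (F q)) p).

(** Wirtinger derivatives: [dz e1] is d/dz1 and [dzbar e1] is d/d(conj z1). *)
Definition dz (e : C2) (F : C2 -> C) (p : C2) : C :=
  Cdiv (Cminus (ddirC e F p) (Cmult Ci (ddirC (C2scal Ci e) F p))) (RtoC 2).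

Definition dzbar (e : C2) (F : C2 -> C) (p : C2) : C :=
  Cdiv (Cplus (ddirC e F p) (Cmult Ci (ddirC (C2scal Ci e) F p))) (RtoC 2).

(** * Boundaries and pseudoconvexity *)

Definition boundary (W : C2 -> Prop) (p : C2) : Prop :=
  forall V : C * C -> Prop, locally (p : C * C) V ->
    (exists q, V q /\ W q) /\ (exists q, V q /\ ~ W q).

Definition bounded_domain (W : C2 -> Prop) : Prop :=
  exists M : R, forall p, W p -> Cmod (fst p) <= M /\ Cmod (snd p) <= M.

Record defining_function (W U : C2 -> Prop) (rho : C2 -> R) : Prop := {
  df_open : open (U : C * C -> Prop);
  df_boundary : forall p, boundary W p -> U p;
  df_smooth : smooth_on U rho;
  df_sign : forall p, U p -> (W p <-> rho p < 0);
  df_nonsing : forall p, boundary W p -> exists v : C2, ddir v rho p <> 0 }.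

Definition smooth_boundary (W : C2 -> Prop) : Prop :=
  exists U rho, defining_function W U rho.

Definition smoothly_bounded (W : C2 -> Prop) : Prop :=
  bounded_domain W /\ smooth_boundary W.

Definition complex_tangent (rho : C2 -> R) (p t : C2) : Prop :=
  Cplus (Cmult (dz e1 (fun q => RtoC (rho q)) p) (fst t))
        (Cmult (dz e2 (fun q => RtoC (rho q)) p) (snd t)) = RtoC 0.

(** [levi_coef rho j k p] is the second derivative of [rho] in z_j and conj z_k.
    The Levi form is real when [rho] is C^2, hence the real part below. *)
Definition levi_coef (rho : C2 -> R) (ej ek : C2) (p : C2) : C :=
  dz ej (dzbar ek (fun q => RtoC (rho q))) p.

Definition levi_form (rho : C2 -> R) (p t : C2) : R :=
  Re (Cplus
   (Cplus (Cmult (levi_coef rho e1 e1 p) (Cmult (fst t) (Cconj (fst t))))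
          (Cmult (levi_coef rho e1 e2 p) (Cmult (fst t) (Cconj (snd t)))))
   (Cplus (Cmult (levi_coef rho e2 e1 p) (Cmult (snd t) (Cconj (fst t))))
          (Cmult (levi_coef rho e2 e2 p) (Cmult (snd t) (Cconj (snd t)))))).

(** Two defining functions have, at a boundary point, the same complex tangent
    space and Levi forms on it that differ by a positive factor, so the choice of
    the defining function in the next two definitions is immaterial. *)
Definition pseudoconvex (W : C2 -> Prop) : Prop :=
  exists U rho, defining_function W U rho /\
    forall p, boundary W p ->
    forall t, complex_tangent rho p t -> 0 <= levi_form rho p t.

Definition strongly_pseudoconvex_at (W : C2 -> Prop) (p : C2) : Prop :=
  boundary W p /\
  exists U rho, defining_function W U rho /\
    forall t, complex_tangent rho p t -> t <> (RtoC 0, RtoC 0) ->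
      0 < levi_form rho p t.

(** * The worm domain *)

Record worm_profile (mu : R) (eta : R -> R) : Prop := {
  wp_smooth : forall n x, ex_derive_n eta n x;
  wp_nonneg : forall x, 0 <= eta x;
  wp_even : forall x, eta (- x) = eta x;
  wp_convex : forall x y t, 0 <= t <= 1 ->
    eta (t * x + (1 - t) * y) <= t * eta x + (1 - t) * eta y;
  wp_zero : forall x, eta x = 0 <-> - mu <= x <= mu;
  wp_large : exists a, 0 < a /\ forall x, Rabs x > a -> eta x > 1;
  wp_transverse : forall x, eta x = 1 -> Derive eta x <> 0 }.

Definition cis (theta : R) : C := (cos theta, sin theta).

Definition log_sq (w : C) : R := ln (Cmod w ^ 2).

(** [ln] is total ([ln 0 = 0]), so z2 <> 0 is required explicitly here and below. *)
Definition worm (eta : R -> R) (z : C2) : Prop :=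
  snd z <> RtoC 0 /\
  Cmod (Cminus (fst z) (cis (log_sq (snd z)))) ^ 2 < 1 - eta (log_sq (snd z)).

Definition exceptional (mu : R) (W : C2 -> Prop) (p : C2) : Prop :=
  boundary W p /\ fst p = RtoC 0 /\ snd p <> RtoC 0 /\
  Rabs (log_sq (snd p)) <= mu.

(* Main.v *)
Require Import Defs.
From Stdlib Require Import Reals Lra List.
From Coquelicot Require Import Coquelicot.
Import ListNotations.
Open Scope R_scope.

(** On [z2 <> 0] put [L = log |z2|^2], [w = z1 e^{-iL}] and
    [rho = |z1 - e^{iL}|^2 - 1 + eta L = |z1|^2 - 2 Re w + eta L], a defining function
    of the worm. Since [L] is pluriharmonic, the Levi form of [rho] at [(t, s z2)] is
    [|t|^2 + 2 Re (i e^{-iL} t conj s) + (2 Re w + eta'' L) |s|^2].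
    On the boundary [2 Re w = |z1|^2 + eta L], and a complex tangent vector satisfies
    [(conj z1 - e^{-iL}) t = - k s] with [k] real; these two facts turn the Levi form
    into [|t - i z1 s|^2 + (eta L + eta'' L) |s|^2], which is nonnegative. If it
    vanishes with [(t, s) <> 0], then [eta L = 0] and [t = i z1 s], and tangency gives
    [|z1|^2 = Re w], whence [z1 = 0].
    Conversely, every defining function vanishes on the annulus, hence so do its
    derivatives in the [z2] directions, by continuity also at the edges; so no
    defining function has a positive Levi form there. *)

(** * Real coordinates and the open set [z2 <> 0] *)

Definition normsq2 (p : C2) : R := fst (snd p) ^ 2 + snd (snd p) ^ 2.

Lemma Cmod_sqr (z : C) : Cmod z ^ 2 = fst z ^ 2 + snd z ^ 2.
Proof. unfold Cmod; apply pow2_sqrt; nra. Qed.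

(** Trades the square root inside [Cmod] for the polynomial [normsq2], which is easy to
    differentiate. *)
Lemma log_sq_normsq2 (p : C2) : log_sq (snd p) = ln (normsq2 p).
Proof. unfold log_sq; now rewrite Cmod_sqr. Qed.

Lemma normsq2_pos (p : C2) : snd p <> RtoC 0 <-> 0 < normsq2 p.
Proof.
  destruct p as [z1 [x y]]; unfold normsq2, RtoC; simpl; split.
  - intros H; destruct (Req_dec x 0) as [-> | ]; [ | nra].
    destruct (Req_dec y 0) as [-> | ]; [ | nra]; now elim H.
  - intros H E; injection E; intros; subst; lra.
Qed.

Lemma continuous_x1 (p : C2) : continuous (fun q : C * C => fst (fst q)) p.
Proof.
  apply (continuous_comp (fst : C * C -> C) (fst : R * R -> R));
    apply continuous_fst.
Qed.

Lemma continuous_y1 (p : C2) : continuous (fun q : C * C => snd (fst q)) p.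
Proof.
  apply (continuous_comp (fst : C * C -> C) (snd : R * R -> R));
    [apply continuous_fst | apply continuous_snd].
Qed.

Lemma continuous_x2 (p : C2) : continuous (fun q : C * C => fst (snd q)) p.
Proof.
  apply (continuous_comp (snd : C * C -> C) (fst : R * R -> R));
    [apply continuous_snd | apply continuous_fst].
Qed.

Lemma continuous_y2 (p : C2) : continuous (fun q : C * C => snd (snd q)) p.
Proof.
  apply (continuous_comp (snd : C * C -> C) (snd : R * R -> R));
    apply continuous_snd.
Qed.

Lemma continuous_normsq2 (p : C2) : continuous (normsq2 : C * C -> R) p.
Proof.
  apply (continuous_ext (fun q : C * C => plus (mult (fst (snd q)) (fst (snd q)))
            (mult (snd (snd q)) (snd (snd q))))).
  { intros q; unfold normsq2, plus, mult; simpl; ring. }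
  apply @continuous_plus; apply @continuous_mult;
    (apply continuous_x2 || apply continuous_y2).
Qed.

Lemma open_snd_neq0 : open ((fun p => snd p <> RtoC 0) : C * C -> Prop).
Proof.
  intros p Hp; apply normsq2_pos in Hp.
  generalize (continuous_normsq2 p _ (open_gt 0 _ Hp)); unfold filtermap.
  apply filter_imp; intros q Hq; now apply normsq2_pos.
Qed.

Lemma normsq2_line (p v : C2) (t : R) : normsq2 (line p v t) =
  (fst (snd p) + t * fst (snd v)) ^ 2 + (snd (snd p) + t * snd (snd v)) ^ 2.
Proof. unfold normsq2; simpl; ring. Qed.

Lemma line_0 (p v : C2) : line p v 0 = p.
Proof.
  destruct p as [[x1 y1] [x2 y2]]; unfold line, C2plus, C2scal, Cplus, Cmult;
    simpl; repeat f_equal; ring.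
Qed.

Lemma continuous_normsq2_line (p v : C2) :
  continuous (fun t => normsq2 (line p v t)) 0.
Proof.
  apply (continuous_ext (fun t => (fst (snd p) + t * fst (snd v)) ^ 2
                                  + (snd (snd p) + t * snd (snd v)) ^ 2)).
  { intros; now rewrite normsq2_line. }
  apply @ex_derive_continuous; auto_derive; trivial.
Qed.

Lemma locally_line_neq0 (p v : C2) : snd p <> RtoC 0 ->
  locally 0 (fun t => snd (line p v t) <> RtoC 0).
Proof.
  intros Hp; apply normsq2_pos in Hp; rewrite <- (line_0 p v) in Hp.
  generalize (continuous_normsq2_line p v _ (open_gt 0 _ Hp)); unfold filtermap.
  apply filter_imp; intros t Ht; now apply normsq2_pos.
Qed.

(** * Smooth functions on [z2 <> 0] *)

(** A syntax for functions on [z2 <> 0], closed under symbolic differentiation;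
    [Inv] stands for [1 / |z2|^2], and [Cos], [Sin], [Eta n] for the cosine, the
    sine and the [n]-th derivative of [eta] at [log |z2|^2]. *)
Inductive expr : Type :=
  | Cst (c : R) | X1 | Y1 | X2 | Y2 | Inv | Cos | Sin | Eta (n : nat)
  | Add (a b : expr) | Mul (a b : expr).

Fixpoint eval (eta : R -> R) (e : expr) (p : C2) : R :=
  match e with
  | Cst c => c
  | X1 => fst (fst p)
  | Y1 => snd (fst p)
  | X2 => fst (snd p)
  | Y2 => snd (snd p)
  | Inv => / normsq2 p
  | Cos => cos (ln (normsq2 p))
  | Sin => sin (ln (normsq2 p))
  | Eta n => Derive_n eta n (ln (normsq2 p))
  | Add a b => eval eta a p + eval eta b p
  | Mul a b => eval eta a p * eval eta b p
  end.

(** The derivative of [ln (normsq2 p)] in the direction [v]. All non-polynomial cases of [diff] have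
    it as a factor. *)
Definition dlog (v : C2) : expr :=
  Mul (Mul (Cst 2) (Add (Mul (Cst (fst (snd v))) X2) (Mul (Cst (snd (snd v))) Y2))) Inv.

Fixpoint diff (v : C2) (e : expr) : expr :=
  match e with
  | Cst _ => Cst 0
  | X1 => Cst (fst (fst v))
  | Y1 => Cst (snd (fst v))
  | X2 => Cst (fst (snd v))
  | Y2 => Cst (snd (snd v))
  | Inv => Mul (Mul (Cst (- 1)) (dlog v)) Inv
  | Cos => Mul (Mul (Cst (- 1)) Sin) (dlog v)
  | Sin => Mul Cos (dlog v)
  | Eta n => Mul (Eta (S n)) (dlog v)
  | Add a b => Add (diff v a) (diff v b)
  | Mul a b => Add (Mul (diff v a) b) (Mul a (diff v b))
  end.

Lemma is_derive_normsq2 (eta : R -> R) (p v : C2) : 0 < normsq2 p ->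
  is_derive (fun t => normsq2 (line p v t)) 0 (eval eta (dlog v) p * normsq2 p).
Proof.
  intros Hp.
  apply (is_derive_ext (fun t => (fst (snd p) + t * fst (snd v)) ^ 2
                                  + (snd (snd p) + t * snd (snd v)) ^ 2)).
  { intros; now rewrite normsq2_line. }
  auto_derive; trivial; simpl; field; lra.
Qed.

Lemma is_derive_comp_normsq2 (eta : R -> R) (p v : C2) (g : R -> R) (l : R) :
  0 < normsq2 p -> is_derive g (normsq2 p) l ->
  is_derive (fun t => g (normsq2 (line p v t))) 0
    (l * normsq2 p * eval eta (dlog v) p).
Proof.
  intros Hp Hg.
  replace (l * normsq2 p * eval eta (dlog v) p)
    with (scal (eval eta (dlog v) p * normsq2 p) l)
    by (unfold scal; simpl; unfold mult; simpl; ring).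
  apply (is_derive_comp g (fun t => normsq2 (line p v t))).
  - now rewrite line_0.
  - now apply is_derive_normsq2.
Qed.

Lemma is_derive_comp_ln (g : R -> R) (x l : R) : 0 < x ->
  is_derive g (ln x) l -> is_derive (fun y => g (ln y)) x (l / x).
Proof.
  intros Hx Hg; replace (l / x) with (scal (/ x) l)
    by (unfold scal; simpl; unfold mult; simpl; field; lra).
  apply (is_derive_comp g ln); trivial; now apply is_derive_ln.
Qed.

Lemma is_derive_eval (eta : R -> R) (Hs : forall n x, ex_derive_n eta n x)
    (e : expr) (p v : C2) : snd p <> RtoC 0 ->
  is_derive (fun t => eval eta e (line p v t)) 0 (eval eta (diff v e) p).
Proof.
  intros Hp; apply normsq2_pos in Hp.
  (* [Cos], [Sin] and [Eta n] are functions of [ln (normsq2 p)]; for these the factor [normsq2 p] of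
     the chain rule cancels against the derivative of [ln]. *)
  assert (Hln : forall g l, is_derive g (ln (normsq2 p)) l ->
    is_derive (fun t => g (ln (normsq2 (line p v t)))) 0 (l * eval eta (dlog v) p)).
  { intros g l Hg.
    replace (l * eval eta (dlog v) p)
      with (l / normsq2 p * normsq2 p * eval eta (dlog v) p)
      by (field_simplify_eq; lra).
    apply (is_derive_comp_normsq2 eta p v (fun y => g (ln y))); trivial.
    now apply is_derive_comp_ln. }
  induction e as [c | | | | | | | | n | a IHa b IHb | a IHa b IHb].
  - apply (is_derive_const c).
  - simpl; auto_derive; trivial; ring.
  - simpl; auto_derive; trivial; ring.
  - simpl; auto_derive; trivial; ring.
  - simpl; auto_derive; trivial; ring.
  - replace (eval eta (diff v Inv) p)
      with (- / normsq2 p ^ 2 * normsq2 p * eval eta (dlog v) p)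
      by (simpl; field; lra).
    apply (is_derive_comp_normsq2 eta p v Rinv); trivial.
    auto_derive; [lra | field; lra].
  - replace (eval eta (diff v Cos) p)
      with (- sin (ln (normsq2 p)) * eval eta (dlog v) p) by (simpl; ring).
    apply (Hln cos); auto_derive; trivial; ring.
  - apply (Hln sin); auto_derive; trivial; ring.
  - apply (Hln (Derive_n eta n)), (Derive_correct (Derive_n eta n)).
    apply (Hs (S n)).
  - now apply (is_derive_plus (fun t => eval eta a (line p v t))).
  - replace (eval eta (diff v (Mul a b)) p)
      with (plus (mult (eval eta (diff v a) p) (eval eta b (line p v 0)))
                 (mult (eval eta a (line p v 0)) (eval eta (diff v b) p)))
      by (now rewrite line_0).
    apply (is_derive_mult (fun t => eval eta a (line p v t))
             (fun t => eval eta b (line p v t))); trivial; intros; apply Rmult_comm.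
Qed.

Lemma continuous_eval (eta : R -> R) (Hs : forall n x, ex_derive_n eta n x)
    (e : expr) (p : C2) : snd p <> RtoC 0 -> continuous (eval eta e : C * C -> R) p.
Proof.
  intros Hp; apply normsq2_pos in Hp.
  assert (Hd : forall g : R -> R, ex_derive g (normsq2 p) ->
    continuous ((fun q => g (normsq2 q)) : C * C -> R) p).
  { intros g Hg; apply (continuous_comp (normsq2 : C * C -> R) g).
    - apply continuous_normsq2.
    - now apply @ex_derive_continuous. }
  induction e as [c | | | | | | | | n | a IHa b IHb | a IHa b IHb].
  - apply continuous_const.
  - apply continuous_x1.
  - apply continuous_y1.
  - apply continuous_x2.
  - apply continuous_y2.
  - apply (Hd Rinv); auto_derive; lra.
  - apply (Hd (fun y => cos (ln y))); auto_derive; lra.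
  - apply (Hd (fun y => sin (ln y))); auto_derive; lra.
  - apply (Hd (fun y => Derive_n eta n (ln y))).
    eexists; apply is_derive_comp_ln; trivial.
    apply (Derive_correct (Derive_n eta n)), (Hs (S n)).
  - now apply (continuous_plus (eval eta a : C * C -> R) (eval eta b)).
  - now apply (continuous_mult (eval eta a : C * C -> R) (eval eta b)).
Qed.

(** A derivative at 0 only sees small [t], for which the line stays in [z2 <> 0]. This allows an
    equality known only on that set to be used under a further [ddir]. *)
Lemma is_derive_line_ext (f g : C2 -> R) (p v : C2) (l : R) :
  (forall q, snd q <> RtoC 0 -> f q = g q) -> snd p <> RtoC 0 ->
  is_derive (fun t => g (line p v t)) 0 l -> is_derive (fun t => f (line p v t)) 0 l.
Proof.
  intros Hfg Hp; apply is_derive_ext_loc.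
  generalize (locally_line_neq0 p v Hp); apply filter_imp.
  intros t Ht; symmetry; now apply Hfg.
Qed.

Lemma ddirs_eval (eta : R -> R) (Hs : forall n x, ex_derive_n eta n x)
    (e : expr) (l : list C2) (p : C2) : snd p <> RtoC 0 ->
  ddirs l (eval eta e) p = eval eta (fold_right diff e l) p.
Proof.
  revert p; induction l as [ | v l IH]; intros p Hp; trivial; simpl.
  apply is_derive_unique.
  apply (is_derive_line_ext _ _ p v _ IH Hp).
  now apply is_derive_eval.
Qed.

Lemma smooth_on_eval (eta : R -> R) (Hs : forall n x, ex_derive_n eta n x)
    (e : expr) : smooth_on (fun p => snd p <> RtoC 0) (eval eta e).
Proof.
  intros l p Hp; pose proof (ddirs_eval eta Hs e l) as He; split.
  - intros v; eexists; apply (is_derive_line_ext _ _ p v _ He Hp).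
    now apply is_derive_eval.
  - apply (continuous_ext_loc _ (eval eta (fold_right diff e l) : C * C -> R)).
    + generalize (open_snd_neq0 p Hp); apply filter_imp.
      intros q Hq; symmetry; now apply He.
    + now apply continuous_eval.
Qed.

(** * The Levi form in real coordinates *)

Lemma Derive_half (f : R -> R) (x : R) : Derive (fun t => f t / 2) x = Derive f x / 2.
Proof.
  unfold Rdiv; rewrite (Derive_ext _ (fun t => / 2 * f t)) by (intros; ring).
  rewrite Derive_scal; ring.
Qed.

(** The shape [(g q / 2, h q / 2)] is the one that [dzbar_RtoC] produces, so this gives the outer
    derivative in [levi_coef]. *)
Lemma dz_half (e : C2) (g h : C2 -> R) (p : C2) :
  dz e (fun q => (g q / 2, h q / 2)) p =
  ((ddir e g p + ddir (C2scal Ci e) h p) / 4, (ddir e h p - ddir (C2scal Ci e) g p) / 4).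
Proof.
  unfold dz, ddirC, ddir; simpl; rewrite !Derive_half.
  unfold Cdiv, Cminus, Cplus, Cmult, Copp, Cinv, Ci, RtoC; simpl; f_equal; field.
Qed.

Lemma dz_RtoC (e : C2) (f : C2 -> R) (p : C2) :
  dz e (fun q => RtoC (f q)) p = (ddir e f p / 2, - ddir (C2scal Ci e) f p / 2).
Proof.
  unfold dz, ddirC, ddir, RtoC; simpl; rewrite !Derive_const.
  unfold Cdiv, Cminus, Cplus, Cmult, Copp, Cinv, Ci; simpl; f_equal; field.
Qed.

Lemma dzbar_RtoC (e : C2) (f : C2 -> R) (p : C2) :
  dzbar e (fun q => RtoC (f q)) p = (ddir e f p / 2, ddir (C2scal Ci e) f p / 2).
Proof.
  unfold dzbar, ddirC, ddir, RtoC; simpl; rewrite !Derive_const.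
  unfold Cdiv, Cminus, Cplus, Cmult, Copp, Cinv, Ci; simpl; f_equal; field.
Qed.

Lemma dz_ext (e : C2) (F G : C2 -> C) (p : C2) :
  (forall q, F q = G q) -> dz e F p = dz e G p.
Proof.
  intros H.
  assert (E : forall v, ddirC v F p = ddirC v G p).
  { intros v; unfold ddirC, ddir; f_equal; apply Derive_ext; intros; now rewrite H. }
  unfold dz; now rewrite !E.
Qed.

Lemma levi_coef_real (rho : C2 -> R) (ej ek p : C2) :
  levi_coef rho ej ek p =
  ((ddir ej (ddir ek rho) p + ddir (C2scal Ci ej) (ddir (C2scal Ci ek) rho) p) / 4,
   (ddir ej (ddir (C2scal Ci ek) rho) p - ddir (C2scal Ci ej) (ddir ek rho) p) / 4).
Proof.
  unfold levi_coef; rewrite <- dz_half; apply dz_ext; intros; apply dzbar_RtoC.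
Qed.

Lemma complex_tangent_real (rho : C2 -> R) (p t : C2) :
  complex_tangent rho p t <->
  ddir e1 rho p * fst (fst t) + ddir (C2scal Ci e1) rho p * snd (fst t)
    + ddir e2 rho p * fst (snd t) + ddir (C2scal Ci e2) rho p * snd (snd t) = 0 /\
  ddir e1 rho p * snd (fst t) - ddir (C2scal Ci e1) rho p * fst (fst t)
    + ddir e2 rho p * snd (snd t) - ddir (C2scal Ci e2) rho p * fst (snd t) = 0.
Proof.
  unfold complex_tangent; rewrite !dz_RtoC.
  unfold Cplus, Cmult, RtoC; simpl; split.
  - intros E; injection E as E1 E2; split; lra.
  - intros [E1 E2]; f_equal; lra.
Qed.

(** * Boundaries *)

(** A nonzero value of [rho] keeps its sign nearby, so a whole neighbourhood would lie in [W] or in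
    its complement. The hypotheses are listed one by one because [worm_defining] uses the lemma
    while its record is still being built. *)
Lemma boundary_level0 (W U : C2 -> Prop) (rho : C2 -> R) (p : C2) :
  open (U : C * C -> Prop) -> U p -> smooth_on U rho ->
  (forall q, U q -> (W q <-> rho q < 0)) -> boundary W p -> rho p = 0.
Proof.
  intros HU Up Hs Hsg Hb.
  destruct (Hs nil p Up) as [_ Hc]; simpl in Hc.
  assert (Hand : forall P : R -> Prop, open P -> P (rho p) ->
    locally (p : C * C) (fun q => U q /\ P (rho q))).
  { intros P HP Hp; apply filter_and; [now apply HU | now apply Hc, HP]. }
  destruct (Rtotal_order (rho p) 0) as [H | [H | H]]; trivial; exfalso.
  - destruct (Hb _ (Hand _ (open_lt 0) H)) as [_ [q [[Uq Hq] nW]]].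
    now apply nW, (Hsg q Uq).
  - destruct (Hb _ (Hand _ (open_gt 0) H)) as [[q [[Uq Hq] Wq]] _].
    apply (Hsg q Uq) in Wq; lra.
Qed.

Lemma exp_le_compat (x y : R) : x <= y -> exp x <= exp y.
Proof. intros [H | ->]; [left; now apply exp_increasing | now right]. Qed.

(** Membership in the worm forces eta < 1 at log |z2|^2, and [wp_large] then bounds this
    logarithm. *)
Lemma profile_bound (mu : R) (eta : R -> R) (heta : worm_profile mu eta) :
  exists a, 0 < a /\ forall p, worm eta p -> exp (- a) <= normsq2 p <= exp a.
Proof.
  destruct (wp_large _ _ heta) as [a [Ha Hl]]; exists a; split; trivial.
  intros p [Hp Hw]; rewrite log_sq_normsq2 in Hw; apply normsq2_pos in Hp.
  assert (Hle : Rabs (ln (normsq2 p)) <= a).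
  { apply Rnot_lt_le; intros H; apply Hl in H.
    pose proof (pow2_ge_0 (Cmod (fst p - cis (ln (normsq2 p))))); lra. }
  apply Rabs_le_between in Hle.
  rewrite <- (exp_ln (normsq2 p)) by trivial.
  split; now apply exp_le_compat.
Qed.

Lemma worm_boundary_neq0 (mu : R) (eta : R -> R) (heta : worm_profile mu eta) (p : C2) :
  boundary (worm eta) p -> snd p <> RtoC 0.
Proof.
  destruct (profile_bound mu eta heta) as [a [_ Ha]]; intros Hb; apply normsq2_pos.
  apply Rnot_le_lt; intros Hle; pose proof (exp_pos (- a)) as He.
  (* If [z2 = 0], this is a neighbourhood of [p] that misses the worm. *)
  destruct (Hb (fun q => normsq2 q < exp (- a))) as [[q [Hq Wq]] _].
  - apply (continuous_normsq2 p (fun y => y < exp (- a))), open_lt; lra.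
  - apply Ha in Wq; lra.
Qed.

Lemma worm_bounded (mu : R) (eta : R -> R) (heta : worm_profile mu eta) :
  bounded_domain (worm eta).
Proof.
  destruct (profile_bound mu eta heta) as [a [Ha0 Ha]].
  assert (1 < exp a) by (rewrite <- exp_0; now apply exp_increasing).
  (* One bound for both coordinates: |z1| is at most 2, |z2|^2 is at most [exp a], and
     [1 < exp a]. *)
  exists (exp a + 1); intros p Wp; split.
  - destruct Wp as [_ Hw].
    assert (Hcis : Cmod (cis (log_sq (snd p))) = 1).
    { unfold Cmod; rewrite <- sqrt_1; f_equal; unfold cis, fst, snd at 1.
      rewrite <- !Rsqr_pow2, Rplus_comm; apply sin2_cos2. }
    pose proof (wp_nonneg _ _ heta (log_sq (snd p))).
    assert (Cmod (fst p - cis (log_sq (snd p))) <= 1).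
    { pose proof (Cmod_ge_0 (fst p - cis (log_sq (snd p)))); nra. }
    replace (fst p) with ((fst p - cis (log_sq (snd p))) + cis (log_sq (snd p)))%C by ring.
    eapply Rle_trans; [apply Cmod_triangle | lra].
  - apply Ha in Wp; unfold normsq2 in Wp; rewrite <- Cmod_sqr in Wp.
    pose proof (Cmod_ge_0 (snd p)); nra.
Qed.

(** * The defining function of the worm *)

Definition worm_rho : expr :=
  Add (Add (Mul (Add X1 (Mul (Cst (-1)) Cos)) (Add X1 (Mul (Cst (-1)) Cos)))
           (Mul (Add Y1 (Mul (Cst (-1)) Sin)) (Add Y1 (Mul (Cst (-1)) Sin))))
      (Add (Eta 0) (Cst (-1))).

Lemma worm_rho_sign (eta : R -> R) (p : C2) :
  snd p <> RtoC 0 -> (worm eta p <-> eval eta worm_rho p < 0).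
Proof.
  intros Hp; unfold worm; rewrite Cmod_sqr, log_sq_normsq2; simpl.
  split; [intros [_ H] | intros H; split; trivial]; lra.
Qed.

Lemma convex_Derive2_nonneg (f : R -> R) (x : R) :
  (forall n y, ex_derive_n f n y) ->
  (forall x y t, 0 <= t <= 1 -> f (t * x + (1 - t) * y) <= t * f x + (1 - t) * f y) ->
  0 <= Derive_n f 2 x.
Proof.
  intros Hs Hc; apply Rnot_lt_le; intros Hneg.
  assert (Hd0 : forall y, is_derive f y (Derive_n f 1 y))
    by (intros y; apply (Derive_correct f), (Hs 1%nat)).
  assert (Hd1 : forall y, is_derive (Derive_n f 1) y (Derive_n f 2 y))
    by (intros y; apply (Derive_correct (Derive_n f 1)), (Hs 2%nat)).
  assert (Hcont : continuous (Derive_n f 2) x)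
    by (apply @ex_derive_continuous; apply (Hs 3%nat)).
  destruct (Hcont (fun y => y < 0) (open_lt 0 _ Hneg)) as [d Hd].
  set (h := d / 2); assert (Hh : 0 < h) by (unfold h; pose proof (cond_pos d); lra).
  assert (Hd' : forall y, x - h <= y <= x + h -> Derive_n f 2 y < 0).
  { intros y Hy; apply Hd; apply Rabs_def1; unfold minus, plus, opp; simpl;
      unfold h in Hy, Hh; lra. }
  assert (Hdec : forall u, 0 < u <= h -> Derive_n f 1 (x + u) - Derive_n f 1 (x - u) < 0).
  { intros u Hu.
    destruct (MVT_cor2 _ _ (x - u) (x + u) ltac:(lra)
                (fun y _ => proj1 (is_derive_Reals _ _ _) (Hd1 y))) as [c [Hc1 Hc2]].
    assert (Derive_n f 2 c < 0) by (apply Hd'; lra); nra. }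
  (* If f'' < 0 near x, then f (x + u) + f (x - u) is strictly decreasing in u,
     against midpoint convexity. *)
  assert (HdF : forall u, is_derive (fun u => f (x + u) + f (x - u)) u
                            (Derive_n f 1 (x + u) - Derive_n f 1 (x - u))).
  { intros u; auto_derive.
    - repeat split; eexists; apply Hd0.
    - simpl; unfold Rminus; ring. }
  destruct (MVT_cor2 _ _ 0 h Hh (fun u _ => proj1 (is_derive_Reals _ _ _) (HdF u)))
    as [c [Hc1 Hc2]].
  specialize (Hc (x + h) (x - h) (1 / 2) ltac:(lra)).
  replace (1 / 2 * (x + h) + (1 - 1 / 2) * (x - h)) with x in Hc by field.
  cbv beta in Hc1; rewrite !Rplus_0_r, !Rminus_0_r in Hc1.
  pose proof (Hdec c ltac:(lra)); nra.
Qed.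

Lemma Derive_min_0 (f : R -> R) (x : R) :
  ex_derive f x -> (forall y, f x <= f y) -> Derive f x = 0.
Proof.
  intros Hd Hm; apply ex_derive_Reals_0 in Hd.
  rewrite <- (Derive_Reals f x Hd).
  apply (deriv_minimum f (x - 1) (x + 1)); try lra; intros; apply Hm.
Qed.

Lemma ddir_eval (eta : R -> R) (Hs : forall n x, ex_derive_n eta n x)
    (e : expr) (v p : C2) : snd p <> RtoC 0 ->
  ddir v (eval eta e) p = eval eta (diff v e) p.
Proof. exact (ddirs_eval eta Hs e [v] p). Qed.

Lemma ddir2_eval (eta : R -> R) (Hs : forall n x, ex_derive_n eta n x)
    (e : expr) (v w p : C2) : snd p <> RtoC 0 ->
  ddir v (ddir w (eval eta e)) p = eval eta (diff v (diff w e)) p.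
Proof. exact (ddirs_eval eta Hs e [v; w] p). Qed.

Lemma worm_defining (mu : R) (eta : R -> R) (heta : worm_profile mu eta) :
  defining_function (worm eta) (fun p => snd p <> RtoC 0) (eval eta worm_rho).
Proof.
  pose proof (wp_smooth _ _ heta) as Hs.
  assert (Hb : forall p, boundary (worm eta) p -> snd p <> RtoC 0)
    by (exact (worm_boundary_neq0 mu eta heta)).
  assert (Hsm : smooth_on (fun p => snd p <> RtoC 0) (eval eta worm_rho))
    by (now apply smooth_on_eval).
  assert (Hsg : forall p, snd p <> RtoC 0 -> (worm eta p <-> eval eta worm_rho p < 0))
    by (intros; now apply worm_rho_sign).
  split; trivial.
  - apply open_snd_neq0.
  - intros p Hp; pose proof (Hb p Hp) as Np.
    assert (H0 : eval eta worm_rho p = 0)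
      by exact (boundary_level0 _ _ _ p open_snd_neq0 Np Hsm Hsg Hp).
    set (L := ln (normsq2 p)).
    (* The two [z1] derivatives vanish together only at z1 = e^{iL}. There [rho = 0] reads eta L =
       1, and [wp_transverse] applies. *)
    destruct (Req_dec (fst (fst p)) (cos L)) as [Ec | Ec].
    2: { exists e1; rewrite ddir_eval by trivial; simpl; fold L; lra. }
    destruct (Req_dec (snd (fst p)) (sin L)) as [Es | Es].
    2: { exists (C2scal Ci e1); rewrite ddir_eval by trivial; simpl; fold L; lra. }
    simpl in H0; fold L in H0; rewrite Ec, Es in H0.
    assert (Hd : Derive eta L <> 0) by (apply (wp_transverse _ _ heta); lra).
    (* In the radial direction of [z2], L has derivative 2, and the cosine and sine terms drop out
       because z1 = e^{iL}; what remains is 2 eta' L. *)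
    exists (RtoC 0, snd p); rewrite ddir_eval by trivial.
    assert (Hl : eval eta (dlog (RtoC 0, snd p)) p = 2).
    { apply normsq2_pos in Np; simpl; unfold normsq2 in *; field; lra. }
    cbn -[dlog]; rewrite Hl; fold L; rewrite Ec, Es; contradict Hd; simpl in Hd.
    change (Derive (fun x => eta x) L) with (Derive eta L) in Hd; lra.
Qed.

(** * Levi form and complex tangent space of the worm *)

(** [(s, c)] is i e^{-iL}, and 1 / conj z2 is the derivative of L in conj z2. The first derivative
    of [eta] cancels in the last coefficient because L is pluriharmonic. *)
Lemma worm_levi_coef (eta : R -> R) (Hs : forall n x, ex_derive_n eta n x) (p : C2) :
  snd p <> RtoC 0 ->
  let c := cos (ln (normsq2 p)) in
  let s := sin (ln (normsq2 p)) in
  levi_coef (eval eta worm_rho) e1 e1 p = RtoC 1 /\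
  levi_coef (eval eta worm_rho) e1 e2 p = Cdiv (s, c) (Cconj (snd p)) /\
  levi_coef (eval eta worm_rho) e2 e1 p = Cdiv (s, - c) (snd p) /\
  levi_coef (eval eta worm_rho) e2 e2 p =
    RtoC ((2 * (fst (fst p) * c + snd (fst p) * s)
             + Derive_n eta 2 (ln (normsq2 p))) / normsq2 p).
Proof.
  intros Hp c s; rewrite !levi_coef_real, !ddir2_eval by trivial.
  apply normsq2_pos in Hp.
  pose proof (sin2_cos2 (ln (normsq2 p))) as Hcs; fold c s in Hcs.
  unfold worm_rho, dlog; cbn -[normsq2 Derive_n].
  fold c s; clearbody c s.
  generalize dependent (Derive_n eta 1 (ln (normsq2 p))).
  generalize dependent (Derive_n eta 2 (ln (normsq2 p))).
  destruct p as [[x1 y1] [x2 y2]]; unfold normsq2 in *; simpl in Hp; simpl.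
  intros d2 d1; unfold Rsqr in Hcs.
  unfold Cdiv, Cmult, Cinv, Cconj, RtoC; simpl.
  repeat split; f_equal; field_simplify_eq; try nra.
Qed.

(** Writing the second component as s z2 cancels the 1 / z2 in the derivative of L and leaves the
    real number [k], the derivative of rho in L with z1 fixed. The equations are the real and
    imaginary parts of (conj z1 - e^{-iL}) t + k s = 0. *)
Lemma worm_complex_tangent (eta : R -> R) (Hs : forall n x, ex_derive_n eta n x)
    (p : C2) (t s : C) : snd p <> RtoC 0 ->
  complex_tangent (eval eta worm_rho) p (t, Cmult s (snd p)) ->
  let c := cos (ln (normsq2 p)) in
  let d := sin (ln (normsq2 p)) in
  let k := Derive eta (ln (normsq2 p)) + 2 * (fst (fst p) * d - snd (fst p) * c) in
  (fst (fst p) - c) * fst t + (snd (fst p) - d) * snd t + k * fst s = 0 /\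
  (fst (fst p) - c) * snd t - (snd (fst p) - d) * fst t + k * snd s = 0.
Proof.
  intros Hp Ht c d k; apply complex_tangent_real in Ht.
  rewrite !ddir_eval in Ht by trivial; apply normsq2_pos in Hp.
  revert Ht; unfold worm_rho, dlog; cbn -[normsq2 Derive_n]; unfold k.
  change (Derive eta) with (Derive_n eta 1).
  fold c d; clearbody c d.
  generalize (Derive_n eta 1 (ln (normsq2 p))); intros d1.
  destruct p as [[x1 y1] [x2 y2]], t as [t1 t2], s as [s1 s2].
  unfold normsq2 in *; simpl in Hp; simpl; intros [E1 E2].
  (* [complex_tangent_real] carries twice the Wirtinger derivatives, hence the factor [/ 2]. *)
  split; [rewrite <- (Rmult_0_r (/ 2)), <- E1 | rewrite <- (Rmult_0_r (/ 2)), <- E2];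
    field; lra.
Qed.

Lemma worm_levi_form (eta : R -> R) (Hs : forall n x, ex_derive_n eta n x)
    (p : C2) (t s : C) : snd p <> RtoC 0 -> eval eta worm_rho p = 0 ->
  complex_tangent (eval eta worm_rho) p (t, Cmult s (snd p)) ->
  levi_form (eval eta worm_rho) p (t, Cmult s (snd p)) =
    Cmod (Cminus t (Cmult Ci (Cmult (fst p) s))) ^ 2
    + (eta (ln (normsq2 p)) + Derive_n eta 2 (ln (normsq2 p))) * Cmod s ^ 2.
Proof.
  intros Hp H0 Ht; pose proof Hp as Np; apply normsq2_pos in Np.
  set (c := cos (ln (normsq2 p))); set (d := sin (ln (normsq2 p))).
  assert (Hcs : d * d + c * c = 1) by exact (sin2_cos2 (ln (normsq2 p))).
  unfold levi_form.
  destruct (worm_levi_coef eta Hs p Hp) as [-> [-> [-> ->]]]; fold c d.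
  rewrite !Cmod_sqr.
  apply (worm_complex_tangent eta Hs) in Ht; trivial; cbv zeta in Ht.
  fold c d in Ht; revert Ht.
  set (k := Derive _ _ + _); clearbody k; intros [E1 E2].
  simpl in H0; change (Derive_n eta 0) with eta in H0; fold c d in H0.
  (* This is |t|^2 + 2 Re (i e^{-iL} t conj s) + (2 Re w + eta'' L) |s|^2 in real coordinates; the
     powers of z2 have cancelled. *)
  replace (Re _) with
    (fst t ^ 2 + snd t ^ 2
     + 2 * ((fst t * d - snd t * c) * fst s + (fst t * c + snd t * d) * snd s)
     + (2 * (fst (fst p) * c + snd (fst p) * d) + Derive_n eta 2 (ln (normsq2 p)))
       * (fst s ^ 2 + snd s ^ 2)).
  - clearbody c d; generalize dependent (eta (ln (normsq2 p))).
    generalize (Derive_n eta 2 (ln (normsq2 p))); intros d2 h H0.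
    destruct p as [[x1 y1] z2], t as [t1 t2], s as [s1 s2]; simpl in *.
    set (B := (x1 + -1 * c) * (x1 + -1 * c) + (y1 + -1 * d) * (y1 + -1 * d) + (h + -1)) in H0.
    apply Rminus_diag_uniq.
    (* The first two terms are twice the imaginary part of conj s times the tangency equation, in
       which the real [k] contributes nothing. The last one subtracts |s|^2 times the boundary
       equation |z1|^2 - 2 Re w + eta L = 0. *)
    match type of E1 with ?a = 0 => match type of E2 with ?b = 0 =>
      transitivity (- 2 * s2 * a + 2 * s1 * b
                    - (B - (d * d + c * c - 1)) * (s1 * s1 + s2 * s2)) end end.
    + unfold B; ring.
    + rewrite E1, E2, H0, Hcs; ring.
  - clear E1 E2 H0; clearbody c d; generalize (Derive_n eta 2 (ln (normsq2 p))).
    destruct p as [[x1 y1] [x2 y2]], t as [t1 t2], s as [s1 s2].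
    unfold normsq2 in *; simpl in Np; intros d2.
    unfold Re, Cdiv, Cmult, Cinv, Cconj, Cplus, RtoC; simpl; field; lra.
Qed.

Lemma C2_snd_mult (t z : C2) : snd z <> RtoC 0 ->
  t = (fst t, Cmult (Cdiv (snd t) (snd z)) (snd z)).
Proof. intros Hz; destruct t; simpl; f_equal; now field. Qed.

Lemma worm_tangent_eta0 (mu : R) (eta : R -> R) (heta : worm_profile mu eta)
    (p : C2) (t s : C) : snd p <> RtoC 0 -> eval eta worm_rho p = 0 ->
  complex_tangent (eval eta worm_rho) p (t, Cmult s (snd p)) ->
  eta (ln (normsq2 p)) = 0 -> t = Cmult Ci (Cmult (fst p) s) -> s <> RtoC 0 ->
  fst p = RtoC 0.
Proof.
  intros Hp H0 Ht He -> Hs; pose proof Hp as Np; apply normsq2_pos in Np.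
  set (c := cos (ln (normsq2 p))); set (d := sin (ln (normsq2 p))).
  assert (Hcs : d * d + c * c = 1) by exact (sin2_cos2 (ln (normsq2 p))).
  assert (Hd : Derive eta (ln (normsq2 p)) = 0).
  { apply (Derive_min_0 eta).
    - apply (wp_smooth _ _ heta 1%nat).
    - intros y; rewrite He; apply (wp_nonneg _ _ heta). }
  apply (worm_complex_tangent eta (wp_smooth _ _ heta)) in Ht; trivial; cbv zeta in Ht.
  simpl in H0; change (Derive_n eta 0) with eta in H0.
  rewrite He in H0; rewrite Hd in Ht; fold c d in Ht, H0; clearbody c d.
  apply Cmod_gt_0 in Hs.
  assert (Hs2 : 0 < fst s ^ 2 + snd s ^ 2) by (rewrite <- Cmod_sqr; nra).
  destruct p as [[x1 y1] z2], s as [s1 s2]; simpl in *; destruct Ht as [E1 E2].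
  (* Again the imaginary part of conj s times the tangency equation, now with t = i z1 s. It yields
     |z1|^2 = Re w, while [H0] says |z1|^2 = 2 Re w. *)
  assert (E : (x1 * x1 + y1 * y1 - (x1 * c + y1 * d)) * (s1 * (s1 * 1) + s2 * (s2 * 1)) = 0).
  { match type of E1 with ?a = 0 => match type of E2 with ?b = 0 =>
      transitivity (s1 * b - s2 * a) end end; [ring | rewrite E1, E2; ring]. }
  apply Rmult_integral in E; destruct E as [E | E]; [ | lra].
  assert (x1 = 0) by nra; assert (y1 = 0) by nra; subst; reflexivity.
Qed.

(** Serves at the edges of the annulus, where only one side of a radial line lies inside. *)
Lemma continuous_eq0_right (g : R -> R) (d : R) : continuous g 0 -> 0 < d ->
  (forall t, 0 < t < d -> g t = 0) -> g 0 = 0.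
Proof.
  intros Hc Hd Hg; destruct (Req_dec (g 0) 0) as [ | H]; trivial; exfalso.
  destruct (Hc (fun y => y <> 0) (open_neq 0 _ H)) as [e He].
  pose proof (cond_pos e) as Pe.
  pose proof (Rmin_l d e); pose proof (Rmin_r d e); pose proof (Rmin_pos d e Hd Pe).
  apply (He (Rmin d e / 2)).
  - apply Rabs_def1; unfold minus, plus, opp; simpl; lra.
  - apply Hg; lra.
Qed.

(** * The annulus in the boundary *)

Lemma Rabs_log_sq (z : C) (m : R) : z <> RtoC 0 ->
  (Rabs (log_sq z) <= m <-> exp (- m / 2) <= Cmod z <= exp (m / 2)).
Proof.
  intros Hz; apply Cmod_gt_0 in Hz.
  assert (E : log_sq z = 2 * ln (Cmod z)).
  { unfold log_sq; simpl; rewrite Rmult_1_r, ln_mult; lra. }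
  rewrite E; pattern (Cmod z) at 2 3; rewrite <- (exp_ln (Cmod z)) by trivial; split.
  - intros H; apply Rabs_le_between in H; split; apply exp_le_compat; lra.
  - intros [H1 H2]; apply Rabs_le_between.
    assert (Hi : forall x y, exp x <= exp y -> x <= y).
    { intros x y H; apply Rnot_lt_le; intros H'; apply exp_increasing in H'; lra. }
    apply Hi in H1, H2; lra.
Qed.

Lemma worm_level0_z1_0 (eta : R -> R) (p : C2) : fst p = RtoC 0 ->
  eval eta worm_rho p = eta (ln (normsq2 p)).
Proof.
  intros E; simpl; rewrite E; simpl.
  pose proof (sin2_cos2 (ln (normsq2 p))) as H; unfold Rsqr in H.
  change (Derive_n eta 0) with eta; lra.
Qed.

Lemma worm_annulus_boundary (mu : R) (eta : R -> R) (heta : worm_profile mu eta)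
    (p : C2) : fst p = RtoC 0 -> snd p <> RtoC 0 -> Rabs (log_sq (snd p)) <= mu ->
  boundary (worm eta) p.
Proof.
  intros E Hp Hmu V HV.
  assert (He : eta (ln (normsq2 p)) = 0).
  { apply (wp_zero _ _ heta), Rabs_le_between; now rewrite <- log_sq_normsq2. }
  split.
  - destruct HV as [d Hd]; pose proof (cond_pos d) as Pd.
    set (r := Rmin d 1 / 2).
    pose proof (Rmin_l d 1); pose proof (Rmin_r d 1).
    assert (Hr : 0 < r <= 1 / 2) by (pose proof (Rmin_pos d 1 Pd Rlt_0_1); unfold r; lra).
    (* Moving z1 from 0 towards the centre e^{iL} brings it to distance 1 - r from that centre,
       below the radius 1 given by eta L = 0. *)
    exists (Cmult (RtoC r) (cis (ln (normsq2 p))), snd p); split.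
    + pose proof (COS_bound (ln (normsq2 p))); pose proof (SIN_bound (ln (normsq2 p))).
      apply Hd; split; [ | apply ball_center].
      destruct p as [z1 z2]; simpl in E; subst z1.
      split; apply Rabs_def1; unfold minus, plus, opp; simpl;
        unfold r in *; nra.
    + split; trivial; rewrite Cmod_sqr; simpl; rewrite log_sq_normsq2, He.
      pose proof (sin2_cos2 (ln (normsq2 p))) as H1; unfold Rsqr in H1.
      set (c := cos _) in *; set (s := sin _) in *.
      apply Rle_lt_trans with ((1 - r) * (1 - r) * (s * s + c * c)); [right; ring | ].
      rewrite H1; nra.
  - exists p; split; [now apply locally_singleton | ].
    rewrite (worm_rho_sign eta p Hp), worm_level0_z1_0, He by trivial; lra.
Qed.

Lemma exceptional_annulus (mu : R) (eta : R -> R) (heta : worm_profile mu eta) (p : C2) :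
  exceptional mu (worm eta) p <->
  fst p = RtoC 0 /\ exp (- mu / 2) <= Cmod (snd p) <= exp (mu / 2).
Proof.
  split.
  - intros [_ [E [Hp Hm]]]; split; trivial; now apply Rabs_log_sq.
  - intros [E Hm].
    assert (Hp : snd p <> RtoC 0).
    { apply Cmod_gt_0; pose proof (exp_pos (- mu / 2)); lra. }
    apply Rabs_log_sq in Hm; trivial.
    split; [now apply (worm_annulus_boundary mu) | now repeat split].
Qed.

(** * Arbitrary defining functions along the annulus *)

(** The annulus is open here so that the property passes to derivatives in the [z2] directions; the
    edges are recovered by continuity. *)
Definition vanishes_on_annulus (mu : R) (f : C2 -> R) : Prop :=
  forall z : C, exp (- mu / 2) < Cmod z < exp (mu / 2) -> f (RtoC 0, z) = 0.

Lemma line_z2 (z v : C) (t : R) :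
  line (RtoC 0, z) (RtoC 0, v) t = (RtoC 0, Cplus z (Cmult (RtoC t) v)).
Proof. unfold line, C2plus, C2scal; simpl; f_equal; ring. Qed.

Lemma vanishes_on_annulus_ddir (mu : R) (f : C2 -> R) (v : C) :
  vanishes_on_annulus mu f -> vanishes_on_annulus mu (ddir (RtoC 0, v) f).
Proof.
  intros Hf z Hz; unfold ddir; transitivity (Derive (fun _ => 0) 0); [ | apply Derive_const].
  apply Derive_ext_loc.
  set (g t := Cmod (Cplus z (Cmult (RtoC t) v))).
  assert (Hg0 : g 0 = Cmod z) by (unfold g; f_equal; ring).
  assert (Hg : continuous g 0).
  { unfold g, Cmod; apply continuous_comp; [ | apply continuous_sqrt].
    apply @ex_derive_continuous; simpl; auto_derive; trivial. }
  rewrite <- Hg0 in Hz; destruct Hz as [H1 H2].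
  generalize (filter_and _ _ (Hg _ (open_gt _ _ H1)) (Hg _ (open_lt _ _ H2))).
  unfold filtermap; apply filter_imp; intros t Ht; rewrite line_z2; now apply Hf.
Qed.

Lemma vanishes_on_closed_annulus (mu : R) (f : C2 -> R) (z : C) : 0 < mu ->
  vanishes_on_annulus mu f ->
  (forall v, ex_derive (fun t => f (line (RtoC 0, z) v t)) 0) ->
  exp (- mu / 2) <= Cmod z <= exp (mu / 2) -> f (RtoC 0, z) = 0.
Proof.
  intros Hmu Hf Hd Hz.
  assert (M1 : 1 < exp (mu / 2)) by (rewrite <- exp_0; apply exp_increasing; lra).
  assert (M2 : exp (- mu / 2) < 1) by (rewrite <- exp_0; apply exp_increasing; lra).
  assert (Hc : forall a : R, Cmod (Cplus z (Cmult (RtoC a) z)) = Rabs (1 + a) * Cmod z).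
  { intros a; rewrite <- Cmod_R, <- Cmod_mult, RtoC_plus; f_equal; ring. }
  (* Approach [z] along the radial points (1 + t k) z with small t > 0. *)
  assert (Hk : forall k d : R, 0 < d ->
    (forall t, 0 < t < d ->
       exp (- mu / 2) < Rabs (1 + t * k) * Cmod z < exp (mu / 2)) -> f (RtoC 0, z) = 0).
  { intros k d Pd H.
    rewrite <- (line_0 (RtoC 0, z) (RtoC 0, Cmult (RtoC k) z)).
    apply (continuous_eq0_right (fun t => f (line (RtoC 0, z) (RtoC 0, Cmult (RtoC k) z) t)) d);
      trivial.
    - apply @ex_derive_continuous, Hd.
    - intros t Ht; rewrite line_z2; apply Hf.
      rewrite Cmult_assoc, <- RtoC_mult, Hc; now apply H. }
  (* Since [0 < mu], the unit circle is strictly inside the annulus. Moving inwards from |z| >= 1 or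
     outwards from |z| < 1 enters the open annulus, and the range of [t] stops before the opposite
     edge. *)
  destruct (Rle_lt_dec 1 (Cmod z)) as [H1 | H1].
  - apply (Hk (- 1) (1 - exp (- mu / 2))); [lra | ].
    pose proof (exp_pos (- mu / 2)).
    intros t Ht; rewrite Rabs_pos_eq by lra; nra.
  - apply (Hk 1 (exp (mu / 2) - 1)); [lra | ].
    pose proof (exp_pos (- mu / 2)).
    intros t Ht; rewrite Rabs_pos_eq by lra; nra.
Qed.

Lemma annulus_not_strongly_pseudoconvex (mu : R) (eta : R -> R) (hmu : 0 < mu)
    (heta : worm_profile mu eta) (p : C2) :
  exceptional mu (worm eta) p -> ~ strongly_pseudoconvex_at (worm eta) p.
Proof.
  intros Hex [_ [U [rho [Hdf Hpos]]]].
  assert (Hb : forall z, exp (- mu / 2) <= Cmod z <= exp (mu / 2) ->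
    boundary (worm eta) (RtoC 0, z)).
  { intros z Hz; now apply (exceptional_annulus mu eta heta (RtoC 0, z)). }
  assert (H0 : vanishes_on_annulus mu rho).
  { intros z Hz; apply (boundary_level0 (worm eta) U); [apply Hdf | | apply Hdf | apply Hdf | ];
      try apply (df_boundary _ _ _ Hdf); apply Hb; lra. }
  apply (exceptional_annulus mu eta heta) in Hex.
  destruct p as [z1 z]; simpl in Hex; destruct Hex as [-> Hz].
  pose proof (df_boundary _ _ _ Hdf _ (Hb z Hz)) as Up.
  (* All iterated [z2] derivatives vanish on the open annulus by induction; smoothness of [rho]
     carries this to the edges. *)
  assert (Hv : forall l : list C,
    ddirs (map (fun v => (RtoC 0, v)) l) rho (RtoC 0, z) = 0).
  { intros l; apply (vanishes_on_closed_annulus mu); trivial.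
    - induction l as [ | v l IH]; trivial; now apply vanishes_on_annulus_ddir.
    - apply (df_smooth _ _ _ Hdf); trivial. }
  assert (Ee : C2scal Ci e2 = (RtoC 0, Ci)) by (unfold C2scal, e2; simpl; f_equal; ring).
  assert (Hd1 : ddir e2 rho (RtoC 0, z) = 0) by exact (Hv [RtoC 1]).
  assert (Hd2 : ddir (C2scal Ci e2) rho (RtoC 0, z) = 0) by (rewrite Ee; exact (Hv [Ci])).
  assert (Hdd1 : ddir e2 (ddir e2 rho) (RtoC 0, z) = 0) by exact (Hv [RtoC 1; RtoC 1]).
  assert (Hdd2 : ddir (C2scal Ci e2) (ddir (C2scal Ci e2) rho) (RtoC 0, z) = 0)
    by (rewrite Ee; exact (Hv [Ci; Ci])).
  (* The direction [e2] is complex tangent because both first [z2] derivatives vanish; its Levi form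
     is a quarter of the Laplacian of [rho] in z2, which is 0. *)
  assert (Hl : 0 < levi_form rho (RtoC 0, z) e2).
  { apply Hpos.
    - apply complex_tangent_real; rewrite Hd1, Hd2; simpl; split; ring.
    - intros E; injection E; lra. }
  revert Hl; unfold levi_form; rewrite (levi_coef_real rho e2 e2), Hdd1, Hdd2.
  unfold Cplus, Cmult, Cconj, Re; simpl; lra.
Qed.

(** * Sign of the Levi form and conclusion *)

Lemma worm_levi_form_cases (mu : R) (eta : R -> R) (heta : worm_profile mu eta)
    (p t : C2) : boundary (worm eta) p -> complex_tangent (eval eta worm_rho) p t ->
  0 <= levi_form (eval eta worm_rho) p t /\
  (~ exceptional mu (worm eta) p -> t <> (RtoC 0, RtoC 0) ->
     0 < levi_form (eval eta worm_rho) p t).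
Proof.
  intros Hb Ht; pose proof (wp_smooth _ _ heta) as Hs.
  pose proof (worm_boundary_neq0 mu eta heta p Hb) as Hp.
  pose proof (worm_defining mu eta heta) as Hdf.
  assert (H0 : eval eta worm_rho p = 0).
  { apply (boundary_level0 (worm eta) (fun p => snd p <> RtoC 0)); trivial; apply Hdf. }
  rewrite (C2_snd_mult t p Hp) in Ht |- *.
  revert Ht; generalize (fst t) (Cdiv (snd t) (snd p)); clear t; intros t s Ht.
  rewrite worm_levi_form by trivial.
  pose proof (wp_nonneg _ _ heta (ln (normsq2 p))) as P1.
  pose proof (convex_Derive2_nonneg eta (ln (normsq2 p)) Hs (wp_convex _ _ heta)) as P2.
  set (q := Cminus t (Cmult Ci (Cmult (fst p) s))).
  pose proof (pow2_ge_0 (Cmod q)) as P3; pose proof (pow2_ge_0 (Cmod s)) as P4.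
  split; [nra | intros Hex Hts].
  assert (Hq : Cmod q ^ 2 = 0 -> t = Cmult Ci (Cmult (fst p) s)).
  { intros E; assert (E' : q = RtoC 0) by (apply Cmod_eq_0; nra).
    unfold q in E'; rewrite <- (Cplus_0_r (Cmult _ _)), <- E'; ring. }
  (* If s = 0 and q = 0, then t = i z1 s = 0 as well, against [Hts]. *)
  assert (Hq0 : 0 < Cmod q ^ 2 \/ s <> RtoC 0).
  { destruct (Ceq_dec s (RtoC 0)) as [-> | ]; [left | now right].
    destruct P3 as [ | P3]; trivial; elim Hts; rewrite (Hq (eq_sym P3)); f_equal; ring. }
  destruct P3 as [P3 | P3]; [nra | ]; destruct Hq0 as [Hq0 | Hs0]; [lra | ].
  assert (P5 : 0 < Cmod s ^ 2) by (apply Cmod_gt_0 in Hs0; nra).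
  (* Now q = 0 and s is nonzero: eta L > 0 makes the form positive because eta'' L >= 0, and eta L =
     0 puts [p] on the annulus. *)
  destruct P1 as [P1 | P1]; [nra | ]; elim Hex.
  split; [trivial | split; [ | split; trivial]].
  - apply (worm_tangent_eta0 mu eta heta p t s); auto.
  - rewrite log_sq_normsq2; apply Rabs_le_between, (wp_zero _ _ heta); auto.
Qed.

Theorem proposition1p3 (mu : R) (eta : R -> R)
    (hmu : 0 < mu) (heta : worm_profile mu eta) :
  smoothly_bounded (worm eta) /\
  pseudoconvex (worm eta) /\
  (forall p : C2, boundary (worm eta) p ->
     (strongly_pseudoconvex_at (worm eta) p <-> ~ exceptional mu (worm eta) p)) /\
  (forall p : C2, exceptional mu (worm eta) p <->
     (fst p = RtoC 0 /\ exp (- mu / 2) <= Cmod (snd p) <= exp (mu / 2))).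
Proof.
  pose proof (worm_defining mu eta heta) as Hdf.
  split; [ | split; [ | split]].
  - split; [now apply (worm_bounded mu) | now eexists; eexists; apply Hdf].
  - eexists; eexists; split; [apply Hdf | ].
    intros p Hb t Ht; now apply (worm_levi_form_cases mu eta heta).
  - intros p Hb; split.
    + intros Hsp Hex; now apply (annulus_not_strongly_pseudoconvex mu eta hmu heta p).
    + intros Hex; split; trivial; eexists; eexists; split; [apply Hdf | ].
      intros t Ht Ht0; now apply (worm_levi_form_cases mu eta heta).
  - apply (exceptional_annulus mu eta heta).
Qed.
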